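(* Let $bG$ be an sm-compactification and $eG$ be an Ellis compactification of a topological group $G$. If $eG\leq bG$, then $eG$ is an sm-compactification of $G$.
   Context: A compactification of $G$ is a compact Hausdorff space with a dense topological embedding of $G$. $eG\le bG$ means that there is a continuous map $bG\to eG$ commuting with the embeddings of $G$. A $G$-compactification of $G$ is a compactification to which the action $\alpha(g,h)=gh$ of $G$ on itself by left multiplication extends to a continuous action $\tilde\alpha$ of $G$. An Ellis compactification $bG$ of $G$ is a $G$-compactification with a monoid operation $\bullet$ such that $(bG,\bullet)$ is a right topological monoid (i.e. $x\mapsto x\bullet y$ is continuous for every $y$) and $\bullet|_{G\times bG}=\tilde\alpha$. An sm-compactification $bG$ of $G$ is a $G$-compactification with a monoid operation $\bullet$ such that $(bG,\bullet)$ is a semitopological monoid (multiplication is separately continuous) and $g\bullet h=gh$ for $g,h\in G$. *)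

(* Defs.v *)
From HB Require Import structures.
From mathcomp Require Import all_boot all_algebra all_classical.
From mathcomp Require Import topology.

Set Implicit Arguments.
Unset Strict Implicit.
Unset Printing Implicit Defensive.

Local Open Scope classical_set_scope.
Local Open Scope group_scope.

(* No compatibility between topology and multiplication is assumed here: which
   translations are continuous is stated separately below. *)
#[short(type="preTopologicalMonoidType")]
HB.structure Definition PreTopologicalMonoid :=
  {M of Topological M & Monoid M}.

#[short(type="preTopologicalGroupType")]
HB.structure Definition PreTopologicalGroup :=
  {G of Topological G & Group G}.

HB.mixin Record PreTopologicalGroup_isTopologicalGroup G
    & PreTopologicalGroup G := {
  mulg_continuous : continuous (fun p : G * G => p.1 * p.2) ;
  invg_continuous : continuous (fun x : G => x^-1)
}.

#[short(type="topologicalGroupType")]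
HB.structure Definition TopologicalGroup :=
  {G of PreTopologicalGroup G & PreTopologicalGroup_isTopologicalGroup G}.

Definition right_topological_monoid (M : preTopologicalMonoidType) : Prop :=
  forall y : M, continuous (fun x : M => x * y).

Definition semitopological_monoid (M : preTopologicalMonoidType) : Prop :=
  (forall y : M, continuous (fun x : M => x * y)) /\
  (forall x : M, continuous (fun y : M => x * y)).

Definition topological_embedding (X Y : topologicalType) (f : X -> Y) : Prop :=
  injective f /\ @open X = @open (initial_topology f).

Definition compactification (X K : topologicalType) (i : X -> K) : Prop :=
  [/\ compact [set: K], hausdorff_space K,
      topological_embedding i & dense (range i)].

(* For compactifications [e : X -> E] and [b : X -> B], this is [E <= B]. *)
Definition compactification_le (X E B : topologicalType)
    (e : X -> E) (b : X -> B) : Prop :=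
  exists2 f : B -> E, continuous f & f \o b = e.

Definition continuous_action (G : topologicalGroupType) (X : topologicalType)
    (a : G -> X -> X) : Prop :=
  [/\ forall x, a 1 x = x,
      forall g h x, a (g * h) x = a g (a h x)
    & continuous (fun p : G * X => a p.1 p.2)].

Definition extended_left_action (G : topologicalGroupType)
    (K : topologicalType) (i : G -> K) (a : G -> K -> K) : Prop :=
  continuous_action a /\ forall g h, a g (i h) = i (g * h).

Definition G_compactification (G : topologicalGroupType)
    (K : topologicalType) (i : G -> K) : Prop :=
  compactification i /\ exists a, extended_left_action i a.

(* The extended action is unique, since [i] has dense range and [K] is
   Hausdorff, so the existential below speaks of the extended action. *)
Definition Ellis_compactification (G : topologicalGroupType)
    (K : preTopologicalMonoidType) (i : G -> K) : Prop :=
  [/\ G_compactification i, right_topological_monoid K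
    & exists2 a, extended_left_action i a & forall g x, i g * x = a g x].

Definition sm_compactification (G : topologicalGroupType)
    (K : preTopologicalMonoidType) (i : G -> K) : Prop :=
  [/\ G_compactification i, semitopological_monoid K
    & forall g h, i g * i h = i (g * h)].

(* Main.v *)
Require Import Defs.
From mathcomp Require Import all_boot all_algebra all_classical.
From mathcomp Require Import topology.

(** The map [f : bG -> eG] witnessing [eG <= bG] is a monoid morphism: the
    identity [f (x * y) = f x * f y] holds on [G * G], extends to [G * bG] by
    density because left translations by elements of [G] are continuous in both
    monoids, and then to [bG * bG] because right translations are. Moreover [f]
    is a surjection from a compact space onto a Hausdorff one, hence a quotient
    map, so each left translation of [eG], being induced through [f] by a left
    translation of [bG], is continuous. *)

Local Open Scope classical_set_scope.
Local Open Scope group_scope.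

(** Neighbourhoods of [f x] and [g x] pull back to a neighbourhood of [x], which meets [D]; the
    common value there lies in both, so Hausdorffness identifies [f x] and [g x]. *)
Lemma eq_continuous_dense (X Y : topologicalType) (D : set X) (f g : X -> Y) :
  hausdorff_space Y -> dense D -> continuous f -> continuous g ->
  {in D, f =1 g} -> f =1 g.
Proof.
move=> hY dD cf cg fg x; apply: hY => A B nA nB.
have : nbhs x (f @^-1` A `&` g @^-1` B).
  by apply: filterI; [exact: cf|exact: cg].
rewrite nbhsE => -[U [oU Ux] UAB].
have [|y [Uy Dy]] := dD U _ oU; first by exists x.
have [Afy Bgy] := UAB _ Uy.
by exists (f y); split=> //; rewrite fg // inE.
Qed.

(** The range of [f] is compact, hence closed, and contains the dense [range i]; a missed point
    would make its complement a nonempty open set avoiding [range i]. *)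
Lemma dense_range_surjective (X K L : topologicalType) (i : X -> L)
    (j : X -> K) (f : K -> L) :
  compact [set: K] -> hausdorff_space L -> continuous f ->
  dense (range i) -> f \o j = i -> forall y, exists x, f x = y.
Proof.
move=> cK hL cf di fj y; apply: contrapT => ny.
have clf : closed (range f).
  apply: compact_closed => //; apply: continuous_compact => //.
  exact: continuous_subspaceT.
have [||z [nfz [t _ tz]]] := di (~` range f).
- by exists y => -[x _ fx]; apply: ny; exists x.
- exact: closed_openC.
- by apply: nfz; exists (j t) => //; rewrite -tz -fj.
Qed.

Lemma continuous_compact_quotient (K L M : topologicalType) (f : K -> L)
    (h : L -> M) :
  compact [set: K] -> hausdorff_space L -> continuous f ->
  (forall y, exists x, f x = y) -> continuous (h \o f) -> continuous h.
Proof.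
move=> cK hL cf sf chf; apply/continuous_closedP => C clC.
have -> : h @^-1` C = f @` ((h \o f) @^-1` C).
  apply/seteqP; split=> [y Chy|_ [x Chfx <-] //].
  by have [x fx] := sf y; exists x; rewrite //= fx.
apply: compact_closed => //; apply: continuous_compact.
  exact: continuous_subspaceT.
apply: subclosed_compact cK _ => //.
by move/continuous_closedP: chf; apply.
Qed.

Lemma continuous_action_translation (G : topologicalGroupType)
    (X : topologicalType) (a : G -> X -> X) (g : G) :
  continuous_action a -> continuous (a g).
Proof.
case=> _ _ ca x.
exact: continuous2_cvg (ca (g, x)) (cvg_cst g) cvg_id.
Qed.

Lemma compactification_le_morphism (G : topologicalGroupType)
    (bG eG : preTopologicalMonoidType) (b : G -> bG) (e : G -> eG)
    (f : bG -> eG) :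
  sm_compactification b -> Ellis_compactification e ->
  continuous f -> f \o b = e -> {morph f : x y / x * y}.
Proof.
move=> [[[_ _ _ db] _] [rb lb] bM] [[[_ he _ _] _] re [a [ca ae] eM]] cf fb.
have fbE g : f (b g) = e g by rewrite -fb.
have fMG g : {morph f : y / b g * y >-> e g * y}.
  apply: (eq_continuous_dense _ _ _ _ _ he db) => [y|y|y].
  - by apply: continuous_comp; [exact: lb|exact: cf].
  (* Left translation by [e g] is continuous because it is the extended action of [g]. *)
  - rewrite (_ : (fun y => _) = a g \o f); last exact/funext.
    by apply: continuous_comp; [exact: cf|exact: (continuous_action_translation _ _ _ g ca)].
  - by rewrite inE => -[h _ <-]; rewrite bM !fbE eM ae.
move=> x y; move: x; apply: (eq_continuous_dense _ _ _ _ _ he db) => [x|x|x].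
- by apply: continuous_comp; [exact: rb|exact: cf].
- exact: continuous_comp (cf x) (re (f y) (f x)).
- by rewrite inE => -[g _ <-]; rewrite fMG fbE.
Qed.

Theorem proposition2p37 (G : topologicalGroupType)
    (bG eG : preTopologicalMonoidType) (b : G -> bG) (e : G -> eG)
    (hb : sm_compactification b) (he : Ellis_compactification e)
    (hle : compactification_le e b) :
  sm_compactification e.
Proof.
have [f cf fb] := hle.
have fM := compactification_le_morphism _ _ _ _ _ _ hb he cf fb.
case: hb => -[[cb _ _ _] _] [_ lb] _.
case: he => eC re [a [_ ae] eM]; have [[_ hE _ de] _] := eC.
have sf := dense_range_surjective _ _ _ _ _ _ cb hE cf de fb.
split=> // [|g h]; last by rewrite eM ae.
split=> // z; have [x <-] := sf z.
apply: (continuous_compact_quotient _ _ _ _ _ cb hE cf sf).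
(* By [fM], left translation by [f x] pulls back along [f] to left translation by [x] in [bG]. *)
rewrite (_ : _ \o f = f \o (fun y => x * y)); last by apply/funext => y /=.
by move=> y; apply: continuous_comp; [exact: lb|exact: cf].
Qed.
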